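(* For a complete first-order theory $T$ the following are equivalent: (1) for every infinite set $A$ (in the monster model) and every formula $\varphi$, there are no more than $|A|$ pairwise 1-contradictory higher $\varphi$-formulas over $A$; (2) $T$ has $NSOP_2$.
   Context: $\mathfrak{C}$ is the monster model. $T$ has $SOP_2$ if some formula $\varphi(\bar x,\bar y)$ admits $\bar a_\eta$ ($\eta\in{}^{\omega>}2$) with each branch $\{\varphi(\bar x,\bar a_{\eta\upharpoonright\ell}):\ell<\omega\}$ consistent and $\{\varphi(\bar x,\bar a_\eta),\varphi(\bar x,\bar a_\nu)\}$ inconsistent for incomparable $\eta,\nu$; $NSOP_2$ is its negation. For $A\subseteq\mathfrak{C}$, an ultrafilter $D$ on ${}^mA$ and $B\subseteq\mathfrak{C}$, $\operatorname{Av}(D,B)=\{\psi(\bar x,\bar b):\bar b\subseteq B,\{\bar a\in{}^mA:\models\psi(\bar a,\bar b)\}\in D\}$. An infinite indiscernible sequence $\langle\bar b_s:s\in I\rangle$ is based on $D$ if $\operatorname{tp}(\bar b_s,A\cup\bigcup_{t>s}\bar b_t)=\operatorname{Av}(D,A\cup\bigcup_{t>s}\bar b_t)$ for all $s\in I$. A higher $\varphi$-formula over $A$ (for $\varphi=\varphi(\bar x,\bar y)$ without parameters, $\ell(\bar y)=m$) is a triple $(\varphi,A,D)$ with $D$ an ultrafilter on ${}^mA$ such that for every infinite indiscernible sequence $\langle\bar b_s:s\in I\rangle$ based on $D$, $\{\varphi(\bar x,\bar b_s):s\in I\}$ is consistent. Given higher formulas $(\varphi_0,A_0,D_0),(\varphi_1,A_1,D_1)$,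 consider sequences $\langle\bar b_s:s\in I\rangle$ where $I$ is a linear order partitioned into $P_0,P_1$ and for $s\in P_i$, $\ell(\bar b_s)=\ell(\bar y_i)$ and $\operatorname{tp}(\bar b_s,A_0\cup A_1\cup\bigcup_{t>s}\bar b_t)\subseteq\operatorname{Av}(D_i,\mathfrak{C})$. $(\varphi_0,A_0,D_0)$ is 1-contradictory to $(\varphi_1,A_1,D_1)$ if for every such sequence and all $s_0<s_1$ with $s_0\in P_0$, $s_1\in P_1$, $\{\varphi_0(\bar x,\bar b_{s_0}),\varphi_1(\bar x,\bar b_{s_1})\}$ is contradictory. A family of higher formulas is pairwise 1-contradictory if any two distinct members are each 1-contradictory to the other. *)

(* Defs.v *)
From HB Require Import structures.
From mathcomp Require Import all_boot all_order.
From mathcomp Require Import boolp classical_sets functions cardinality filter.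

Set Implicit Arguments.
Unset Strict Implicit.
Unset Printing Implicit Defensive.

Local Open Scope classical_set_scope.
Local Open Scope card_scope.

Record language := Language {
  fsym : Type;
  rsym : Type;
  farity : fsym -> nat;
  rarity : rsym -> nat
}.

(* The type [V] is the type of free variables; [fAll] binds the variable
   [None] of [option V].  A formula in the tuple of variables x_0 .. x_(n-1) is
   a [formula L 'I_n], and a formula phi(x,y) with n = l(x), m = l(y) is a
   [formula L ('I_n + 'I_m)]. *)
Inductive term (L : language) (V : Type) : Type :=
| tVar of V
| tApp (f : fsym L) of ('I_(farity f) -> term L V).

Inductive formula (L : language) (V : Type) : Type :=
| fFalse
| fEq of term L V & term L V
| fRel (r : rsym L) of ('I_(rarity r) -> term L V)
| fImp of formula L V & formula L V
| fAll of formula L (option V).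

Arguments fFalse {L V}.

Definition sentence (L : language) := formula L void.

Definition fNot (L : language) (V : Type) (phi : formula L V) : formula L V :=
  fImp phi fFalse.

Record structure (L : language) := Structure {
  carrier :> Type;
  carrier_inhabited : inhabited carrier;
  funI : forall f : fsym L, ('I_(farity f) -> carrier) -> carrier;
  relI : forall r : rsym L, ('I_(rarity r) -> carrier) -> Prop
}.

Fixpoint teval (L : language) (M : structure L) (V : Type) (v : V -> M)
    (t : term L V) : M :=
  match t with
  | tVar x => v x
  | tApp f ts => @funI L M f (fun i => teval v (ts i))
  end.

Fixpoint sat (L : language) (M : structure L) (V : Type) (v : V -> M)
    (phi : formula L V) {struct phi} : Prop :=
  match phi with
  | fFalse => False
  | fEq t u => teval v t = teval v u
  | fRel r ts => @relI L M r (fun i => teval v (ts i))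
  | fImp phi psi => sat v phi -> sat v psi
  | fAll phi => forall a : M, sat (fun x => if x is Some y then v y else a) phi
  end.

Definition models (L : language) (M : structure L) (sigma : sentence L) : Prop :=
  sat (M := M) (of_void M) sigma.

Definition is_model (L : language) (T : set (sentence L)) (M : structure L) :
    Prop :=
  T `<=` models M.

Definition entails (L : language) (T : set (sentence L)) (sigma : sentence L) :
    Prop :=
  forall M : structure L, is_model T M -> models M sigma.

Definition complete_theory (L : language) (T : set (sentence L)) : Prop :=
  (exists M : structure L, is_model T M) /\
  (forall sigma : sentence L, entails T sigma \/ entails T (fNot sigma)).

(* A formula psi(x, c) in an n-tuple x of variables, with parameters c in M. *)
Record pformula (L : language) (M : structure L) (n : nat) := PFormula {
  pf_len : nat;
  pf_formula : formula L ('I_n + 'I_pf_len);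
  pf_param : 'I_pf_len -> M
}.

Arguments pf_param {L M n} p _.

Definition join_val (X Y Z : Type) (f : X -> Z) (g : Y -> Z) (v : X + Y) : Z :=
  match v with inl x => f x | inr y => g y end.

Definition psat (L : language) (M : structure L) (n : nat) (a : 'I_n -> M)
    (psi : pformula M n) : Prop :=
  sat (join_val a (pf_param psi)) (pf_formula psi).

Definition over (L : language) (M : structure L) (n : nat) (B : set M) :
    set (pformula M n) :=
  [set psi | range (pf_param psi) `<=` B].

(* Consistency with the elementary diagram of M, that is, finite
   satisfiability in M. *)
Definition consistent (L : language) (M : structure L) (n : nat)
    (p : set (pformula M n)) : Prop :=
  forall q : set (pformula M n), finite_set q -> q `<=` p ->
    exists a : 'I_n -> M, q `<=` psat a.

Definition tp (L : language) (M : structure L) (n : nat) (a : 'I_n -> M)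
    (B : set M) : set (pformula M n) :=
  over (n := n) B `&` psat a.

Definition elementary_on (L : language) (M : structure L) (B : set M)
    (f : M -> M) : Prop :=
  forall (k : nat) (psi : formula L 'I_k) (c : 'I_k -> M), range c `<=` B ->
    (sat c psi <-> sat (f \o c) psi).

Definition automorphism (L : language) (M : structure L) (g : M -> M) : Prop :=
  [/\ bijective g,
      forall (f : fsym L) (c : 'I_(farity f) -> M),
        g (funI c) = funI (g \o c) &
      forall (r : rsym L) (c : 'I_(rarity r) -> M),
        relI c <-> relI (g \o c)].

(* The cardinal |K| plays the role of the saturation of the monster model. *)
Definition small (K U : Type) (X : set U) : Prop := ~ ([set: K] #<= X).

Definition saturated (L : language) (K : Type) (M : structure L) : Prop :=
  forall (B : set M) (n : nat) (p : set (pformula M n)),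
    small K B -> p `<=` over (n := n) B -> consistent p ->
    exists a : 'I_n -> M, p `<=` psat a.

Definition strongly_homogeneous (L : language) (K : Type) (M : structure L) :
    Prop :=
  forall (B : set M) (f : M -> M), small K B -> elementary_on B f ->
    exists g : M -> M, automorphism g /\ {in B, g =1 f}.

(* [formula L nat] has cardinality |L| + aleph_0. *)
Definition monster (L : language) (K : Type) (T : set (sentence L))
    (C : structure L) : Prop :=
  [/\ is_model T C, small K [set: formula L nat], saturated K C &
      strongly_homogeneous K C].

Definition incomparable (eta nu : seq bool) : bool :=
  ~~ prefix eta nu && ~~ prefix nu eta.

Definition SOP2 (L : language) (C : structure L) : Prop :=
  exists (n m : nat) (phi : formula L ('I_n + 'I_m))
         (a : seq bool -> 'I_m -> C),
    (forall eta : nat -> bool,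
       consistent (range (fun l => PFormula phi (a (mkseq eta l))))) /\
    (forall eta nu : seq bool, incomparable eta nu ->
       ~ consistent [set PFormula phi (a eta); PFormula phi (a nu)]).

Definition NSOP2 (L : language) (C : structure L) : Prop := ~ SOP2 C.

Definition Av (L : language) (C : structure L) (m : nat) (A : set C)
    (D : set_system ('I_m -> A)) (B : set C) : set (pformula C m) :=
  over (n := m) B `&` [set psi | D [set a | psat (fun i => val (a i)) psi]].

Definition indiscernible (L : language) (C : structure L) (d : Order.disp_t)
    (I : orderType d) (m : nat) (b : I -> 'I_m -> C) : Prop :=
  forall (k : nat) (s t : 'I_k -> I),
    {homo s : i j / (i < j)%N >-> (i < j)%O} ->
    {homo t : i j / (i < j)%N >-> (i < j)%O} ->
    forall psi : formula L ('I_k * 'I_m),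
      sat (fun ij => b (s ij.1) ij.2) psi <-> sat (fun ij => b (t ij.1) ij.2) psi.

Definition later (L : language) (C : structure L) (d : Order.disp_t)
    (I : orderType d) (len : I -> nat) (b : forall s : I, 'I_(len s) -> C)
    (s : I) : set C :=
  \bigcup_(t in [set t | (s < t)%O]) range (b t).

Definition based_on (L : language) (C : structure L) (m : nat) (A : set C)
    (D : set_system ('I_m -> A)) (d : Order.disp_t) (I : orderType d)
    (b : I -> 'I_m -> C) : Prop :=
  forall s : I, tp (b s) (A `|` later b s) = Av D (A `|` later b s).

Record triple (L : language) (C : structure L) (n : nat) := Triple {
  t_len : nat;
  t_phi : formula L ('I_n + 'I_t_len);
  t_set : set C;
  t_ultra : set_system ('I_t_len -> t_set)
}.

Arguments t_ultra {L C n} t _.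

Definition higher_formula (L : language) (K : Type) (C : structure L) (n : nat)
    (h : triple C n) : Prop :=
  UltraFilter (t_ultra h) /\
  forall (d : Order.disp_t) (I : orderType d) (b : I -> 'I_(t_len h) -> C),
    infinite_set [set: I] -> small K [set: I] ->
    indiscernible b -> based_on (t_ultra h) b ->
    consistent (range (fun s => PFormula (t_phi h) (b s))).

(* The partition of I into P_0 and P_1 is given by its characteristic function:
   s is in P_0 when [side s = false] and in P_1 when [side s = true]. *)
Definition one_contradictory (L : language) (K : Type) (C : structure L)
    (n : nat) (h0 h1 : triple C n) : Prop :=
  let h (i : bool) := if i then h1 else h0 in
  forall (d : Order.disp_t) (I : orderType d) (side : I -> bool)
         (b : forall s : I, 'I_(t_len (h (side s))) -> C),
    small K [set: I] ->
    (forall s : I, tp (b s) (t_set h0 `|` t_set h1 `|` later b s) `<=`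
                   Av (t_ultra (h (side s))) [set: C]) ->
    forall s0 s1 : I, (s0 < s1)%O -> side s0 = false -> side s1 = true ->
      ~ consistent [set PFormula (t_phi (h (side s0))) (b s0);
                        PFormula (t_phi (h (side s1))) (b s1)].

(* The members (phi, A, D) of a family of higher phi-formulas over A differ only
   by D, so such a family is a set [F] of ultrafilters D. *)
Definition pairwise_one_contradictory_family (L : language) (K : Type)
    (C : structure L) (n m : nat) (phi : formula L ('I_n + 'I_m)) (A : set C)
    (F : set (set_system ('I_m -> A))) : Prop :=
  (forall D, F D -> higher_formula K (Triple phi D)) /\
  (forall D D', F D -> F D' -> D <> D' ->
     one_contradictory K (Triple phi D) (Triple phi D')).

(* Main.v *)
(* For [SOP2 -> ~ (1)], let A be the countable set of entries of an SOP2 tree,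
   and attach to each of the 2^aleph_0 branches an ultrafilter containing its
   tails.  Indiscernible sequences based on it inherit the consistency of the branch,
   and two distinct branches are eventually incomparable.

   For [NSOP2 -> (1)], suppose that F has more than |A| members.  Sequences
   realizing average types show that for D <> D' in F, D-most a are inconsistent
   with D'-most a', and that D-most a_1, D-most a_2, ... are jointly consistent.
   Repeated pigeonhole over finite trees labelled by tuples of A, of which there
   are only |A|, then yields SOP2 trees of every finite height, and saturation
   an infinite one. *)

From Stdlib Require List.
Require Import Defs.
From mathcomp Require Import all_boot all_order.
From mathcomp Require Import boolp classical_sets functions cardinality filter.

Local Open Scope classical_set_scope.
Local Open Scope card_scope.

Set Implicit Arguments.
Unset Strict Implicit.
Unset Printing Implicit Defensive.

(** * Cardinality *)

(** The ultrafilters give only nested information: for D-most a, the tuple a is inconsistent with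
    D'-most a', and the exceptional a' depend on a. A tree needs every node of one subtree
    inconsistent with every node of its sibling, so one subtree has to be fixed before the labels of
    the other are restricted, and it must not depend on the ultrafilters from which the other is
    grown. Having more than |A| members is read as not embedding in A. This survives the removal of
    one member, and any map into a set of size at most |A| has a fibre where it persists. The second
    fact rests on |A x A| = |A| for an arbitrary infinite A, derived here from Zorn's lemma. Both
    directions pass between realizations of average types and tuples of A by one transfer principle.
    A tuple realizes the average type over those of larger index, so the tuple of least index is
    always the one replaced first. *)

Definition embeds (T U : Type) : Prop := exists f : T -> U, injective f.

Lemma embeds_trans (T U V : Type) : embeds T U -> embeds U V -> embeds T V.
Proof. by move=> [f fI] [g gI]; exists (g \o f); exact: inj_comp. Qed.

Lemma card_le_embeds (T U : Type) (A : set T) (B : set U) :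
  A #<= B <-> embeds A B.
Proof.
split=> [/card_leP/injfunPex[f _ fI]|[f fI]].
  by exists f => x y; apply: fI; rewrite inE.
by apply/card_leP/injfunPex; exists f => // x y _ _; exact: fI.
Qed.

Lemma cardT_le_embeds (T U : Type) (B : set U) : [set: T] #<= B <-> embeds T B.
Proof.
rewrite card_le_embeds; split=> -[f fI].
  by exists (fun x => f (SigSub (mem_set (I : setT x)))) => x y /fI[].
by exists (f \o val); apply: inj_comp fI val_inj.
Qed.

Section Comparability.
Variables (T U : Type).

Let pinj (G : set (T * U)) : Prop :=
  (forall x y y', G (x, y) -> G (x, y') -> y = y') /\
  (forall x x' y, G (x, y) -> G (x', y) -> x = x').

(** A maximal partial injection is total or onto: otherwise a point outside its domain could be
    matched with one outside its range. *)
Lemma embeds_total : embeds T U \/ embeds U T.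
Proof.
have [|G [[Gf Gi] Gmax]] := @Zorn_bigcup _ pinj.
  move=> F FP Ftot.
  have two p q : (\bigcup_(X in F) X) p -> (\bigcup_(X in F) X) q ->
      exists2 G, pinj G & G p /\ G q.
    move=> [X FX Xp] [Y FY Yq]; case: (Ftot _ _ FX FY) => le.
      by exists Y; [exact: FP | split=> //; exact: le].
    by exists X; [exact: FP | split=> //; exact: le].
  split.
    by move=> x y y' h1 h2; have [G [Gf _] [g1 g2]] := two _ _ h1 h2;
      exact: Gf g1 g2.
  by move=> x x' y h1 h2; have [G [_ Gi] [g1 g2]] := two _ _ h1 h2;
    exact: Gi g1 g2.
have [tot|/existsNP[x0 nx0]] := pselect (forall x, exists y, G (x, y)).
  by left; have [f fG] := choice tot; exists f => x x' E; apply: Gi (fG x) _;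
    rewrite E.
have [tot|/existsNP[y0 ny0]] := pselect (forall y, exists x, G (x, y)).
  by right; have [f fG] := choice tot; exists f => x x' E; apply: Gf (fG x) _;
    rewrite E.
case: (Gmax (G `|` [set (x0, y0)])).
  split; first by move=> p Gp; left.
  by move=> /(_ (x0, y0) (or_intror erefl)) g; apply: nx0; exists y0.
split.
  move=> x y y' [g|e] [g'|e']; first exact: Gf g g'.
  - by case: nx0; exists y; case: e' => <-.
  - by case: nx0; exists y'; case: e => <-.
  - by case: e => _ ->; case: e' => _ ->.
move=> x x' y [g|e] [g'|e']; first exact: Gi g g'.
- by case: ny0; exists x; case: e' => _ <-.
- by case: ny0; exists x'; case: e => _ <-.
- by case: e => -> _; case: e' => -> _.
Qed.

End Comparability.

Section Square.
Variable X : Type.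

(** The domain is meant to be a full square, so the diagonal determines its side. *)
Let field (G : set (X * X * X)) : set X := [set x | exists z, G (x, x, z)].

(* [G] is the graph of an injection of Y * Y into Y, where Y = [field G]. *)
Let squares (G : set (X * X * X)) : Prop :=
  [/\ forall p z z', G (p, z) -> G (p, z') -> z = z',
      forall p p' z, G (p, z) -> G (p', z) -> p = p',
      forall x y, field G x -> field G y -> exists z, G (x, y, z) &
      forall x y z, G (x, y, z) -> [/\ field G x, field G y & field G z]].

(** Let [G] be maximal with field Y. Either the complement of Y embeds in Y, and then so does X; or
    it contains a copy of Y, and then [G] extends to a larger square. *)
Lemma embeds_square : embeds nat X -> embeds (X * X) X.
Proof.
move=> [e eI].
pose G0 : set (X * X * X) :=
  [set p | exists i j, p = (e i, e j, e (pickle (i, j)))].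
have fG0 x : field G0 x <-> exists i, x = e i.
  split=> [[z [i [j [-> _ _]]]]|[i ->]]; first by exists i.
  by exists (e (pickle (i, i))), i, i.
have sG0 : squares G0.
  split.
  - by move=> p z z' [i [j [-> ->]]] [i' [j' [[/eI -> /eI ->] ->]]].
  - move=> p p' z [i [j [-> ->]]] [i' [j' [-> /eI/(pcan_inj pickleK)[-> ->]]]]
      //.
  - by move=> x y /fG0[i ->] /fG0[j ->]; exists (e (pickle (i, j))), i, j.
  - by move=> x y z [i [j [-> -> ->]]]; split; apply/fG0; eexists.
(* Adjoining [G0] puts the range of [e] inside the maximal field, which supplies the distinct tags
   [e 0] and [e 1]. *)
have [|G' [sG Gmax']] := @Zorn_bigcup _ (fun G => squares (G `|` G0)).
  move=> F FP Ftot; set H := _ `|` _.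
  have two p q : H p -> H q ->
      exists2 G, squares G & [/\ G `<=` H, G p & G q].
    have sub Y : F Y -> Y `|` G0 `<=` H.
      by move=> FY r [Yr|?]; [left; exists Y | right].
    move=> [[Y FY Yp]|Hp] [[Z FZ Zq]|Hq]; last by exists G0 => //;
      split=> // r; right.
    - case: (Ftot _ _ FY FZ) => le.
        by exists (Z `|` G0); [exact: FP | split; [exact: sub|left;
          exact: le|left]].
      by exists (Y `|` G0); [exact: FP | split; [exact: sub|left|left;
        exact: le]].
    - by exists (Y `|` G0); [exact: FP | split; [exact: sub|left|right]].
    - by exists (Z `|` G0); [exact: FP | split; [exact: sub|right|left]].
  split.
  - move=> p z z' h1 h2; have [G [Gf _ _ _] [_ g1 g2]] := two _ _ h1 h2;
      exact: Gf g1 g2.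
  - move=> p p' z h1 h2; have [G [_ Gi _ _] [_ g1 g2]] := two _ _ h1 h2;
      exact: Gi g1 g2.
  - move=> x y [z h1] [z' h2]; have [G [_ _ Gt _] [le g1 g2]] := two _ _ h1 h2.
    by have [||w ?] := Gt x y; [exists z|exists z'|exists w; apply: le].
  - move=> x y z h; have [G [_ _ _ Gr] [le g _]] := two _ _ h h.
    by have [[u ?] [v ?] [w ?]] := Gr _ _ _ g; split; eexists; apply: le;
      eassumption.
set G := G' `|` G0 in sG.
have Gmax B : squares B -> G `<=` B -> B `<=` G.
  move=> sB GB p Bp; apply: contrapT => nGp; apply: (Gmax' B).
    split; first by move=> q Gq; apply: GB; left.
    by move=> BG'; apply: nGp; left; exact: BG'.
  by rewrite setUidl// => q G0q; apply: GB; right.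
have [Gf Gi Gt Gr] := sG.
set Y := field G.
have Ye i : Y (e i) by exists (e (pickle (i, i))); right; exists i, i.
have /choice[f fG] (p : X * X) : exists z, Y p.1 -> Y p.2 -> G (p, z).
  have [[Y1 Y2]|n] := pselect (Y p.1 /\ Y p.2); last first.
    by exists p.1 => Y1 Y2; case: n.
  by case: p Y1 Y2 => x y /= Y1 Y2; have [z ?] := Gt _ _ Y1 Y2; exists z.
have fY x y : Y x -> Y y -> Y (f (x, y)).
  by move=> Yx Yy; have [] := Gr _ _ _ (fG (x, y) Yx Yy).
have fI x y x' y' : Y x -> Y y -> Y x' -> Y y' -> f (x, y) = f (x', y') ->
    x = x' /\ y = y'.
  move=> Yx Yy Yx' Yy' E.
  have g := fG (x', y') Yx' Yy'; rewrite -E in g.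
  by case: (Gi _ _ _ (fG (x, y) Yx Yy) g).
have e01 : e 0 <> e 1 by move=> /eI.
have [[h hI]|[h hI]] := embeds_total (~` Y) Y.
  (* [g] embeds X in Y; the second coordinates [e 0] and [e 1] keep Y apart from its complement. *)
  have /choice[g gP] x : exists y, Y y /\
      ((Y x /\ y = f (x, e 0)) \/
       exists nx : x \in ~` Y, y = f (val (h (SigSub nx)), e 1)).
    have [Yx|nYx] := pselect (Y x); first by exists (f (x, e 0)); split;
      [exact: fY|left].
    have nx : x \in ~` Y by rewrite inE.
    exists (f (val (h (SigSub nx)), e 1)); split; last by right; exists nx.
    by apply: fY => //; exact: set_valP.
  have gY x : Y (g x) by case: (gP x).
  have gI : injective g.
    move=> x y E; have [_ Hx] := gP x; have [_ Hy] := gP y; rewrite -E in Hy.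
    case: Hx => [[Yx ->]|[nx ->]] in Hy; case: Hy => [[Yy]|[ny]] /fI[]//;
      try exact: set_valP.
      by move=> _ /eI.
    by move=> /val_inj/hI[].
  exists (fun p => f (g p.1, g p.2)) => -[x y] [x' y'] /=.
  by move=> /fI[]// /gI -> /gI ->.
(* [Z] is a copy of Y outside Y. The new pairs over the union of Y and Z are coded in Y by [r] and
   [f], then moved to Z by [h], so [S] shares no value with [G]. *)
pose Z := range (fun y : Y => val (h y)).
have nYZ x : Y x -> Z x -> False.
  by move=> Yx [y _ E]; apply: (set_valP (h y)); rewrite E.
have /choice[r rP] x : exists y, Y x \/ Z x -> Y y /\
    ((Y x /\ y = f (x, e 0)) \/
     exists u : Y, x = val (h u) /\ y = f (val u, e 1)).
  have [Yx|nYx] := pselect (Y x).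
    by exists (f (x, e 0)) => _; split; [exact: fY|left].
  have [[u _ E]|nZx] := pselect (Z x); last by exists x => -[].
  exists (f (val u, e 1)) => _; split; last by right; exists u.
  by apply: fY => //; exact: set_valP.
have rY x : Y x \/ Z x -> Y (r x) by move=> /rP[].
have rI x y : Y x \/ Z x -> Y y \/ Z y -> r x = r y -> x = y.
  move=> Hx Hy E; have [_ {}Hx] := rP _ Hx; have [_ {}Hy] := rP _ Hy.
  rewrite -E in Hy.
  case: Hx => [[Yx ->]|[u [xu ->]]] in Hy; case: Hy => [[Yy]|[v [yv]]] /fI[]//;
    try exact: set_valP.
    by move=> _ /eI.
  by rewrite xu yv => /val_inj ->.
pose k (p : X * X) := f (r p.1, r p.2).
have kY p : Y p.1 \/ Z p.1 -> Y p.2 \/ Z p.2 -> Y (k p).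
  by move=> /rY ? /rY ?; exact: fY.
pose S : set (X * X * X) := [set p | [/\ Y p.1.1 \/ Z p.1.1, Y p.1.2 \/ Z p.1.2,
  ~ (Y p.1.1 /\ Y p.1.2) & exists u : Y, val u = k p.1 /\ p.2 = val (h u)]].
have SZ p z : S (p, z) -> Z z by move=> [_ _ _ [u [_ /= ->]]]; exists u.
have kS p : Y p.1 \/ Z p.1 -> Y p.2 \/ Z p.2 -> ~ (Y p.1 /\ Y p.2) ->
    exists z, S (p, z).
  move=> H1 H2 H3; have yk : k p \in Y by rewrite inE; exact: kY.
  by exists (val (h (SigSub yk))); split=> //; exists (SigSub yk).
have fGS x : field (G `|` S) x <-> Y x \/ Z x.
  split=> [[z [g|[]]]//|]; first by left; exists z.
  have [Yx _|nYx H] := pselect (Y x); first by case: Yx => z ?; exists z; left.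
  by have [||/= []//|z ?] := kS (x, x) => //; exists z; right.
have sGS : squares (G `|` S).
  split.
  - move=> p z z' [g|s] [g'|s']; first exact: Gf g g'.
    + case: p => x y in g s'; case: s' => _ _ []; by case: (Gr _ _ _ g).
    + case: p => x y in g' s; case: s => _ _ []; by case: (Gr _ _ _ g').
    + case: s s' => _ _ _ [u [uk /= ->]] [_ _ _ [v [vk /= ->]]].
      by congr (val (h _)); apply: val_inj; rewrite uk vk.
  - have G_S p p' z : G (p, z) -> S (p', z) -> False.
      case: p => x y g /SZ Zz; case: (Gr _ _ _ g) => _ _ Yz; exact: nYZ Yz Zz.
    move=> p p' z [g|s] [g'|s']; first exact: Gi g g'.
    + by case: (G_S _ _ _ g s').
    + by case: (G_S _ _ _ g' s).
    + case: s s' => H1 H2 _ [u [uk /= ->]]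
        [H1' H2' _ [v [vk /= /val_inj/hI uv]]].
      move: vk; rewrite -uv uk => /fI[]; rewrite /=; try exact: rY.
      by case: p p' H1 H2 H1' H2' {uk} => x y [x' y'] /= *; congr pair;
        exact: rI.
  - move=> x y /fGS Hx /fGS Hy.
    have [[Yx Yy]|n] := pselect (Y x /\ Y y).
      by have [z ?] := Gt _ _ Yx Yy; exists z; left.
    by have [||//|z ?] := kS (x, y) => //; exists z; right.
  - move=> x y z [g|s].
      by have [? ? ?] := Gr _ _ _ g; split; apply/fGS; left.
    have Zz := SZ _ _ s; case: s => /= ? ? _ _.
    by split; apply/fGS => //; right.
(* Maximality forces Z into Y; the image of [e 0] shows that Z is nonempty, a contradiction. *)
have zZ : Z (val (h (SigSub (mem_set (Ye 0))))) by eexists.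
have [z Gz] : Y (val (h (SigSub (mem_set (Ye 0))))).
  have [z zS] : field (G `|` S) (val (h (SigSub (mem_set (Ye 0))))).
    by apply/fGS; right.
  by exists z; apply: Gmax sGS _ _ zS => p; left.
by case: (nYZ _ _ zZ); exists z.
Qed.

End Square.

Inductive tree (S : Type) : Type :=
| Leaf
| Node of S & tree S & tree S.

Arguments Leaf {S}.

Section InfiniteType.
Variables (X : Type) (Xinf : embeds nat X).

(** [None] will code a leaf, and pairs will assemble a node from its parts. *)
Lemma embeds_option_square : embeds (option (X * X)) X.
Proof.
have [p pI] := embeds_square Xinf; have [e eI] := Xinf.
exists (fun o => if o is Some q then p (e 0, p q) else p (e 1, e 1)).
by move=> [q|] [q'|] // /pI[] // => [/pI ->|/eI|/eI].
Qed.

Lemma embeds_sum : embeds (X + nat) X.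
Proof.
have [p pI] := embeds_square Xinf; have [e eI] := Xinf.
exists (fun o => match o with inl x => p (e 0, x) | inr n => p (e 1, e n) end).
by move=> [x|n] [x'|n'] /pI[] => [->|/eI|/eI|/eI->].
Qed.

Lemma embeds_finfun (m : nat) : embeds ('I_m -> X) X.
Proof.
have [p pI] := embeds_square Xinf; have [e eI] := Xinf.
elim: m => [|m [f fI]].
  by exists (fun=> e 0) => g h _; apply/funext => -[].
exists (fun g => p (g ord0, f (g \o lift ord0))) => g h /pI[g0 /fI gS].
apply/funext => i; have [j ->|->//] := unliftP ord0 i.
exact: (congr1 (@^~ j) gS).
Qed.

Lemma embeds_tree (S : Type) : embeds S X -> embeds (tree S) X.
Proof.
move=> [g gI]; have [p pI] := embeds_option_square.
pose f := fix f (t : tree S) := match t with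
  | Leaf => p None
  | Node s t0 t1 => p (Some (g s, p (Some (f t0, f t1))))
  end.
exists f; elim=> [|s t0 IH0 t1 IH1] [|s' t0' t1'] //= /pI //.
by move=> [/gI ->] /pI[/IH0 -> /IH1 ->].
Qed.

(* Otherwise the fibres would embed [G] into X * X. *)
Lemma pigeonhole (T S : Type) (G : set T) (f : T -> S) :
  embeds S X -> ~ embeds G X ->
  exists s, ~ embeds (G `&` [set x | f x = s] : set T) X.
Proof.
move=> [e eI] nG; apply: contrapT => H; apply: nG.
have fib s : embeds (G `&` [set x | f x = s] : set T) X.
  by apply: contrapT => n; apply: H; exists s.
pose g s := projT1 (cid (fib s)).
have gI s : injective (g s) := projT2 (cid (fib s)).
have Gf (x : G) : (val x : T) \in G `&` [set y | f y = f (val x)].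
  by rewrite inE; split=> //; exact: set_valP.
have [p pI] := embeds_square Xinf.
exists (fun x => p (e (f (val x)), g (f (val x)) (SigSub (Gf x)))).
move=> x y /pI[/eI fxy]; move: (Gf x) (Gf y) => Hx; rewrite -fxy => Hy /gI[].
exact: val_inj.
Qed.

End InfiniteType.

(** If the members other than [x] embed in X, send [x] to a new point; X absorbs it by
    [embeds_sum]. *)
Lemma embeds_remove (T X : Type) (G : set T) (x : T) :
  embeds nat X -> ~ embeds G X -> ~ embeds (G `\ x) X.
Proof.
move=> Xinf nG; apply: contra_not nG => -[f fI].
apply: embeds_trans (embeds_sum Xinf).
have /choice[g gP] (y : G) : exists z,
    (val y = x /\ z = inr 0) \/
    exists ny : (val y : T) \in G `\ x, z = inl (f (SigSub ny)).
  have [yx|nyx] := pselect (val y = x); first by exists (inr 0); left.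
  have ny : (val y : T) \in G `\ x by rewrite inE; split=> //; exact: set_valP.
  by exists (inl (f (SigSub ny))); right; exists ny.
exists g => y z E; apply: val_inj.
case: (gP y) (gP z) => [[-> yE]|[ny yE]] [[-> zE]|[nz zE]] //.
- by move: E; rewrite yE zE.
- by move: E; rewrite yE zE.
- by move: E; rewrite yE zE => -[] /fI[].
Qed.

Lemma card_leU_countable (T : Type) (A B : set T) :
  infinite_set A -> countable B -> A `|` B #<= A.
Proof.
move=> /infiniteP/cardT_le_embeds Ai /countable_injP[c cI].
apply/card_le_embeds; apply: embeds_trans (embeds_sum Ai).
have /choice[g gP] (y : (A `|` B : set T)) : exists z,
    (exists ny : (val y : T) \in A, z = inl (SigSub ny)) \/
    (B (val y) /\ z = inr (c (val y))).
  case: (set_valP y) => [/mem_set Ay|By]; first by exists (inl (SigSub Ay));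
    left; exists Ay.
  by exists (inr (c (val y))); right.
exists g => y z E; apply: val_inj.
case: (gP y) (gP z) => [[ny yE]|[/mem_set By yE]] [[nz zE]|[/mem_set Bz zE]].
- by move: E; rewrite yE zE => -[].
- by move: E; rewrite yE zE.
- by move: E; rewrite yE zE.
- by move: E; rewrite yE zE => -[]; exact: cI.
Qed.

Lemma cantor_bool_seq : ~ embeds (nat -> bool) nat.
Proof.
move=> [f fI].
pose g n := `[< exists2 h, f h = n & h n = false >].
have [gT|gF] := boolP (g (f g)).
  by move/asboolP: (gT) => [h /fI ->]; rewrite gT.
by apply: (negP gF); apply/asboolP; exists g => //; exact/negbTE.
Qed.

(** * Formulas and definable predicates *)

Fixpoint trename (L : language) (U V : Type) (f : U -> V) (t : term L U) :
    term L V :=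
  match t with
  | tVar x => tVar L (f x)
  | tApp g ts => tApp (fun i => trename f (ts i))
  end.

Fixpoint frename (L : language) (U V : Type) (f : U -> V) (phi : formula L U) :
    formula L V :=
  match phi with
  | fFalse => fFalse
  | fEq t u => fEq (trename f t) (trename f u)
  | fRel r ts => fRel (fun i => trename f (ts i))
  | fImp phi psi => fImp (frename f phi) (frename f psi)
  | fAll phi => fAll (frename (omap f) phi)
  end.

Lemma teval_rename (L : language) (C : structure L) (U V : Type) (f : U -> V)
    (v : V -> C) (t : term L U) : teval v (trename f t) = teval (v \o f) t.
Proof. by elim: t => //= g ts IH; congr funI; apply/funext => i; exact: IH. Qed.

Lemma sat_rename (L : language) (C : structure L) (U V : Type) (f : U -> V)
    (v : V -> C) (phi : formula L U) : sat v (frename f phi) = sat (v \o f) phi.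
Proof.
elim: phi V f v => //=.
- by move=> {}U t u V f v; rewrite !teval_rename.
- move=> {}U r ts V f v; congr relI; apply/funext => i; exact: teval_rename.
- by move=> {}U phi IHphi psi IHpsi V f v; rewrite IHphi IHpsi.
- move=> {}U phi IH V f v; apply: eq_forall => a; rewrite IH.
  by congr sat; apply/funext => -[].
Qed.

Lemma In_mem (T : eqType) (x : T) (s : seq T) : List.In x s <-> x \in s.
Proof.
elim: s => //= y s IH; rewrite inE; split.
  by move=> [->|/IH->]; rewrite ?eqxx ?orbT.
by move=> /orP[/eqP->|/IH]; [left|right].
Qed.

Section Definability.
Variables (L : language) (C : structure L).

(** Definability is semantic, and parameters are indexed by any finite type, so that combining two
    predicates just takes the sum of their index types. *)
Definition pdef (B : set C) (V : Type) (P : (V -> C) -> Prop) : Prop :=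
  exists (W : finType) (p : W -> C) (phi : formula L (V + W)),
    range p `<=` B /\ forall v, P v <-> sat (join_val v p) phi.

Lemma pdef_ext (B : set C) (V : Type) (P Q : (V -> C) -> Prop) :
  (forall v, P v <-> Q v) -> pdef B P -> pdef B Q.
Proof. by move=> PQ; suff -> : P = Q by []; apply/funext => v;
  exact/propext. Qed.

Lemma pdef_sub (B B' : set C) (V : Type) (P : (V -> C) -> Prop) :
  B `<=` B' -> pdef B P -> pdef B' P.
Proof.
by move=> BB' [W [p [phi [pB H]]]]; exists W, p, phi; split=> //;
  exact: subset_trans pB BB'.
Qed.

Lemma pdef_sat (B : set C) (V : Type) (phi : formula L V) :
  pdef B (fun v => sat v phi).
Proof.
exists void, (of_void C), (frename inl phi); split=> [x [[]]|v].
by rewrite sat_rename.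
Qed.

(** The common form of renaming variables and of freezing them at parameters: [f] decides which of
    the two happens to each variable. *)
Lemma pdef_subst (B : set C) (V V' : Type) (U : finType) (f : V -> V' + U)
    (p : U -> C) (P : (V -> C) -> Prop) : range p `<=` B -> pdef B P ->
  pdef B (fun v : V' -> C => P (join_val v p \o f)).
Proof.
move=> pB [W [q [phi [qB H]]]].
pose g (x : V + W) : V' + (U + W) := match x with
  | inl y => match f y with inl z => inl z | inr u => inr (inl u) end
  | inr w => inr (inr w) end.
exists (U + W)%type, (join_val p q), (frename g phi).
split=> [_ [[u|w] _ <-]|v]; [by apply: pB; exists u|by apply: qB; exists w|].
rewrite sat_rename H; suff -> : join_val (join_val v p \o f) q =
  join_val v (join_val p q) \o g by [].
by apply/funext => -[y|w] //=; case: (f y).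
Qed.

Lemma pdef_rename (B : set C) (V V' : Type) (f : V -> V') (P :
  (V -> C) -> Prop) :
  pdef B P -> pdef B (fun v : V' -> C => P (v \o f)).
Proof. by apply: (@pdef_subst _ _ _ void (inl \o f) (of_void C)) => x [[]]. Qed.

Lemma pdef_imp (B : set C) (V : Type) (P Q : (V -> C) -> Prop) :
  pdef B P -> pdef B Q -> pdef B (fun v => P v -> Q v).
Proof.
move=> [W [p [phi [pB HP]]]] [W' [p' [psi [pB' HQ]]]].
pose f (x : V + W) : V + (W + W') := match x with
  | inl y => inl y | inr w => inr (inl w) end.
pose g (x : V + W') : V + (W + W') := match x with
  | inl y => inl y | inr w => inr (inr w) end.
exists (W + W')%type, (join_val p p'), (fImp (frename f phi) (frename g psi)).
split=> [_ [[u|w] _ <-]|v]; [by apply: pB; exists u|by apply: pB'; exists w|].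
rewrite /= !sat_rename HP HQ.
have -> : join_val v (join_val p p') \o f = join_val v p by apply/funext => -[].
by have -> : join_val v (join_val p p') \o g = join_val v p' by apply/funext =>
  -[].
Qed.

Lemma pdef_not (B : set C) (V : Type) (P : (V -> C) -> Prop) :
  pdef B P -> pdef B (fun v => ~ P v).
Proof. by move=> HP; apply: pdef_imp (HP) (pdef_sat B fFalse). Qed.

Lemma pdef_cst (B : set C) (V : Type) (b : Prop) : pdef B (fun _ : V -> C => b).
Proof.
have [bT|bF] := pselect b; last first.
  by apply: pdef_ext (pdef_sat B fFalse) => v; split=> [[]|/bF].
by apply: pdef_ext (pdef_not (pdef_sat B fFalse)) => v; split=> // _ [].
Qed.

Lemma pdef_and (B : set C) (V : Type) (P Q : (V -> C) -> Prop) :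
  pdef B P -> pdef B Q -> pdef B (fun v => P v /\ Q v).
Proof.
move=> HP HQ; apply: pdef_ext (pdef_not (pdef_imp HP (pdef_not HQ))) => v /=.
by split=> [/not_implyP[? /contrapT]|[? ?]]; [split|apply].
Qed.

Lemma pdef_all_in (B : set C) (V T : Type) (l : seq T)
    (P : T -> (V -> C) -> Prop) :
  (forall t, List.In t l -> pdef B (P t)) ->
  pdef B (fun v => forall t, List.In t l -> P t v).
Proof.
elim: l => [|t l IH] H.
  by apply: pdef_ext (pdef_cst B V True) => v; split.
apply: pdef_ext (pdef_and (H t (or_introl erefl)) (IH _)) => [v|u ul].
  by split=> [[Pt Pl] u [<-|/Pl]|H']; last split=> [|u ul]; try (apply: H';
    by [left|right]).
by apply: H; right.
Qed.

Lemma pdef_all_fin (B : set C) (V : Type) (I : finType)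
    (P : I -> (V -> C) -> Prop) :
  (forall i, pdef B (P i)) -> pdef B (fun v => forall i, P i v).
Proof.
move=> H; apply: pdef_ext (@pdef_all_in B V I (enum I) P (fun i _ => H i)) => v.
by split=> // Pv i; apply: Pv; apply/In_mem; rewrite mem_enum.
Qed.

Lemma pdef_ex (B : set C) (V : Type) (P : (option V -> C) -> Prop) :
  pdef B P ->
  pdef B (fun v : V -> C => exists a, P (fun x =>
    if x is Some y then v y else a)).
Proof.
move=> /pdef_not[W [p [phi [pB H]]]].
pose f (x : option V + W) : option (V + W) := match x with
  | inl (Some y) => Some (inl y) | inl None => None | inr w => Some (inr w) end.
suff /pdef_not : pdef B (fun v : V -> C =>
    forall a, ~ P (fun x => if x is Some y then v y else a)).
  by apply: pdef_ext => v; split=> [/existsNP[a /contrapT]|[a ? /(_ a)]//];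
    exists a.
exists W, p, (fAll (frename f phi)); split=> // v /=.
by split=> + a; move=> /(_ a); rewrite sat_rename H; congr sat;
  apply/funext => -[[]|].
Qed.

Lemma pdef_ex_fin (B : set C) (V : Type) (W : finType) (P :
  (V + W -> C) -> Prop) :
  pdef B P -> pdef B (fun v : V -> C => exists w : W -> C, P (join_val v w)).
Proof.
have ord k : forall (V : Type) (P : (V + 'I_k -> C) -> Prop),
    pdef B P -> pdef B (fun v => exists w : 'I_k -> C, P (join_val v w)).
  elim: k => [|k IH] {}V {}P HP.
    pose f (x : V + 'I_0) : V :=
      match x with inl y => y | inr i => False_rect V (notF (ltn_ord i)) end.
    apply: pdef_ext (pdef_rename f HP) => v; split=> [H|[w]].
      have [c] := carrier_inhabited C; exists (fun=> c).
      by move: H; congr P; apply/funext => -[|[]].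
    by congr P; apply/funext => -[|[]].
  pose f (x : V + 'I_k.+1) : option V + 'I_k := match x with
    | inl y => inl (Some y)
    | inr i => if unlift ord0 i is Some j then inr j else inl None end.
  apply: pdef_ext (pdef_ex (IH _ _ (pdef_rename f HP))) => v /=.
  split=> [[a [w H]]|[w H]].
    exists (fun i => if unlift ord0 i is Some j then w j else a).
    by move: H; congr P; apply/funext => -[y|i] //=; case: unlift.
  exists (w ord0), (w \o lift ord0).
  by move: H; congr P; apply/funext => -[y|i] //=; case: unliftP => [j|] ->.
move=> HP.
pose f (x : V + W) : V + 'I_#|W| :=
  match x with inl y => inl y | inr w => inr (enum_rank w) end.
apply: pdef_ext (ord _ _ _ (pdef_rename f HP)) => v; split=> -[w H].
  by exists (w \o enum_rank); move: H; congr P; apply/funext => -[].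
exists (w \o enum_val); move: H; congr P; apply/funext => -[|i] //=.
by rewrite enum_rankK.
Qed.

Lemma pdef_pformula (B : set C) (n : nat) (P : ('I_n -> C) -> Prop) :
  pdef B P ->
  exists2 psi : pformula C n, Defs.over B psi & forall a, psat a psi <-> P a.
Proof.
move=> [W [p [phi [pB H]]]].
pose f (x : 'I_n + W) : 'I_n + 'I_#|W| :=
  match x with inl y => inl y | inr w => inr (enum_rank w) end.
exists (PFormula (frename f phi) (p \o enum_val)).
  by move=> _ [i _ <-]; apply: pB; eexists.
move=> a; rewrite H /psat /= sat_rename.
suff -> : join_val a (p \o enum_val) \o f = join_val a p by [].
by apply/funext => -[|w] //=; rewrite enum_rankK.
Qed.

End Definability.

(** * Consistency *)

Lemma finite_set_list (T : Type) (q : set T) :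
  finite_set q <-> exists l : seq T, q = [set x | List.In x l].
Proof.
split=> [/(@finite_seqP {classic T})[s ->]|[l ->]].
  by exists s; apply/seteqP; split=> x /(@In_mem {classic T}).
elim: l => [|x l IH].
  suff -> : [set x : T | List.In x [::]] = set0 by exact: finite_set0.
  by apply/seteqP; split.
suff -> : [set y : T | List.In y (x :: l)] = x |` [set y | List.In y l].
  by rewrite finite_setU; split.
by apply/seteqP; split=> y /= [->|]; [left|right|left|right].
Qed.

Section Consistency.
Variables (L : language) (C : structure L) (n m : nat).
Variable (phi : formula L ('I_n + 'I_m)).

(** Lists suffice because consistency is a finitary condition; see [consistent_image]. *)
Definition jointly_sat (l : seq ('I_m -> C)) : Prop :=
  exists x : 'I_n -> C, forall c, List.In c l -> sat (join_val x c) phi.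

Lemma jointly_sat_sub (l l' : seq ('I_m -> C)) :
  (forall c, List.In c l' -> List.In c l) -> jointly_sat l -> jointly_sat l'.
Proof. by move=> ll' [x H]; exists x => c /ll'/H. Qed.

Lemma jointly_satC (c c' : 'I_m -> C) :
  jointly_sat [:: c; c'] -> jointly_sat [:: c'; c].
Proof. by apply: jointly_sat_sub => d /= [->|[->|[]]]; [right; left|left]. Qed.

Lemma consistent_image (S : set ('I_m -> C)) :
  consistent [set PFormula phi c | c in S] <->
  forall l, (forall c, List.In c l -> S c) -> jointly_sat l.
Proof.
split=> [cS l lS|H q /finite_set_list[l ->] lS].
  have [|_ [c cl <-]|x Hx] := cS [set PFormula phi c | c in [set c | List.In c
    l]].
  - by apply: finite_image; apply/finite_set_list; exists l.
  - by exists c => //; exact: lS.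
  - by exists x => c cl; apply: (Hx (PFormula phi c)); exists c.
suff [l' l'S ll'] : exists2 l', (forall c, List.In c l' -> S c) &
    forall psi, List.In psi l -> exists2 c, List.In c l' & psi = PFormula phi c.
  have [x Hx] := H _ l'S; exists x => psi /ll'[c cl ->]; exact: Hx.
elim: l lS {H} => [|psi l IH] lS; first by exists [::].
have [|l' l'S ll'] := IH; first by move=> psi' ?; apply: lS; right.
have [c Sc <-] := lS psi (or_introl erefl).
exists (c :: l') => [d [<-//|/l'S//]|psi' [<-|/ll'[d dl' ->]]].
  by exists c => //; left.
by exists d => //; right.
Qed.

Lemma consistent_range (I : Type) (b : I -> 'I_m -> C) :
  consistent (range (fun s => PFormula phi (b s))) <->
  forall l : seq I, jointly_sat [seq b s | s <- l].
Proof.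
have -> : range (fun s => PFormula phi (b s)) = [set PFormula phi c | c in
  range b].
  by apply/seteqP; split=> [_ [s _ <-]|_ [_ [s _ <-] <-]];
    [exists (b s)|exists s].
rewrite consistent_image; split=> H l.
  by apply: H => c; elim: l => //= s l IH [<-|/IH//]; exists s.
move=> lb; suff [k ->] : exists k, l = [seq b s | s <- k] by exact: H.
elim: l lb => [|c l IH] lb; first by exists [::].
have [s _ <-] := lb c (or_introl erefl).
have [|k ->] := IH; first by move=> d dl; apply: lb; right.
by exists (s :: k).
Qed.

Lemma consistent_pair (c c' : 'I_m -> C) :
  consistent [set PFormula phi c; PFormula phi c'] <-> jointly_sat [:: c; c'].
Proof.
have -> : [set PFormula phi c; PFormula phi c'] =
    [set PFormula phi d | d in [set d | d = c \/ d = c']].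
  apply/seteqP; split=> [_ [->|->]|_ [_ [->|->] <-]].
  - by exists c => //; left.
  - by exists c' => //; right.
  - by left.
  - by right.
rewrite consistent_image; split=> [|H l lcc'].
  by apply=> d /= [->|[->|[]]]; [left|right].
by apply: jointly_sat_sub H => d /lcc'[->|->]; [left|right; left].
Qed.

(** Each listed tuple is a block of variables or a fixed tuple from [B]; the common solution is then
    quantified away. *)
Lemma pdef_jointly_sat (B : set C) (V T : Type) (l : seq T)
    (G : T -> (V -> C) -> 'I_m -> C) :
  (forall t, List.In t l -> (exists f, forall v, G t v = v \o f) \/
     (exists2 c, range c `<=` B & forall v, G t v = c)) ->
  pdef B (fun v => jointly_sat [seq G t v | t <- l]).
Proof.
move=> HG; pose P t (v : V + 'I_n -> C) :=
  sat (join_val (v \o inr) (G t (v \o inl))) phi.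
have HP t : List.In t l -> pdef B (P t).
  move=> /HG[[f fG]|[c cB cG]].
    pose g (x : 'I_n + 'I_m) : V + 'I_n :=
      match x with inl i => inr i | inr j => inl (f j) end.
    apply: pdef_ext (pdef_rename g (pdef_sat B phi)) => v.
    by rewrite /P fG; suff -> : v \o g = join_val (v \o inr) (v \o inl \o f) by
      [];
       apply/funext => -[].
  pose g (x : 'I_n + 'I_m) : (V + 'I_n) + 'I_m :=
    match x with inl i => inl (inr i) | inr j => inr j end.
  apply: pdef_ext (pdef_subst g cB (pdef_sat B phi)) => v.
  by rewrite /P cG; suff -> : join_val v c \o g = join_val (v \o inr) c by [];
     apply/funext => -[].
apply: pdef_ext (pdef_ex_fin (pdef_all_in HP)) => v.
split=> -[x Hx]; exists x.
  by move=> c /List.in_map_iff[t [<- /Hx]].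
by move=> t tl; apply: Hx; apply/List.in_map_iff; exists t.
Qed.

Lemma pdef_jointly_sat_cons (B : set C) (l : seq ('I_m -> C)) :
  (forall c, List.In c l -> range c `<=` B) ->
  pdef B (fun y => jointly_sat (y :: l)).
Proof.
move=> lB; pose G (o : option ('I_m -> C)) (y : 'I_m -> C) :=
  if o is Some c then c else y.
apply: pdef_ext (@pdef_jointly_sat B 'I_m _ (None :: map Some l) G _).
  by move=> y /=; rewrite -map_comp (@eq_map _ _ _ id) ?map_id.
move=> o [<-|/List.in_map_iff[c [<- /lB cB]]]; first by left; exists id.
by right; exists c.
Qed.

End Consistency.

(** * Realizations of average types *)

Lemma small_card_le (K U U' : Type) (X : set U) (Y : set U') :
  X #<= Y -> small K Y -> small K X.
Proof. by move=> XY; apply: contra_not => KX; exact: card_le_trans KX XY. Qed.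

Lemma small_countable (L : language) (K U : Type) (X : set U) :
  small K [set: formula L nat] -> countable X -> small K X.
Proof.
move=> sK cX; apply: small_card_le sK; apply: card_le_trans cX _.
apply/cardT_le_embeds; exists (fun k => SigSub (mem_set (I :
  setT (fEq (tVar L k) (tVar L k))))).
by move=> k k' [].
Qed.

Section Generic.
Variables (L : language) (K : Type) (C : structure L) (m : nat).

Definition tval (A : set C) (a : 'I_m -> A) : 'I_m -> C := fun i => val (a i).

Lemma range_tval (A : set C) (a : 'I_m -> A) : range (tval a) `<=` A.
Proof. by move=> _ [i _ <-]; exact: set_valP. Qed.

(** [b] realizes the average type. One inclusion yields equality of types ([generic_tp]), as an
    ultrafilter decides every formula. *)
Definition generic (A : set C) (D : set_system ('I_m -> A)) (B : set C)
    (b : 'I_m -> C) : Prop := Av D B `<=` psat b.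

Section Fixed.
Variables (A : set C) (D : set_system ('I_m -> A)).
Hypothesis DU : UltraFilter D.

(** Finitely many formulas of the average type hold together on a D-large set, which is nonempty;
    saturation does the rest. *)
Lemma generic_exists (B : set C) : saturated K C -> small K B ->
  exists b, generic D B b.
Proof.
move=> satC sB; apply: satC sB _ _; first by move=> psi [].
move=> q /finite_set_list[l ->] lD.
suff /filter_ex[a Ha] : D [set a | forall psi, List.In psi l -> psat (tval a)
  psi].
  by exists (tval a).
elim: l lD => [|psi l IH] lD; first by apply: filterS filterT => a _ psi [].
have [_ Dpsi] := lD psi (or_introl erefl).
apply: filterS2 Dpsi (IH _) => [a ? H psi' [<-//|/H//]|psi' ?].
by apply: lD; right.
Qed.

(** The transfer principle between realizations and D-most tuples of A. If [P] held at [b] but not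
    D-often, its negation would be D-large and hence true of [b]. *)
Lemma generic_pdef (B : set C) (b : 'I_m -> C) (P : ('I_m -> C) -> Prop) :
  generic D B b -> pdef B P -> P b <-> D [set a | P (tval a)].
Proof.
move=> gb PB.
have imp Q : pdef B Q -> D [set a | Q (tval a)] -> Q b.
  move=> /pdef_pformula[psi psiB psiQ] DQ; apply/psiQ; apply: gb.
  by split=> //; apply: filterS DQ => a Qa; exact/psiQ.
split; last exact: imp.
move=> Pb; have [//|nP] := in_ultra_setVsetC [set a | P (tval a)] DU.
by case: (imp _ (pdef_not PB) nP).
Qed.

Lemma generic_psat (B : set C) (b : 'I_m -> C) (psi : pformula C m) :
  generic D B b -> Defs.over B psi ->
  psat b psi <-> D [set a | psat (tval a) psi].
Proof.
move=> gb psiB; apply: (generic_pdef (P := psat (n := m) ^~ psi) gb).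
by exists 'I_(pf_len psi), (pf_param psi), (pf_formula psi).
Qed.

Lemma generic_tp (B : set C) (b : 'I_m -> C) :
  generic D B b -> tp b B = Av D B.
Proof.
move=> gb; apply/seteqP; split=> psi [psiB] H; split=> //.
  exact/(generic_psat gb).
exact/(generic_psat gb psiB).
Qed.

(** The tuple of least index is generic over the others, so it may be replaced by D-most tuples of
    A; for each of these the induction hypothesis compares the remaining tuples. *)
Lemma generic_indiscernible (d : Order.disp_t) (I : orderType d)
    (b : I -> 'I_m -> C) :
  (forall s, generic D (A `|` later b s) (b s)) -> indiscernible b.
Proof.
move=> gb k s t sI tI psi.
(* Parameters from [A] are allowed because the induction freezes the first tuple at a member of
   [A]. *)
suff H : forall (P : ('I_k * 'I_m -> C) -> Prop), pdef A P ->
    P (fun ij => b (s ij.1) ij.2) <-> P (fun ij => b (t ij.1) ij.2).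
  exact: (H (fun v => sat v psi) (pdef_sat A psi)).
elim: k s t sI tI {psi} => [|k IH] s t sI tI P PA.
  by suff -> : (fun ij : 'I_0 * 'I_m => b (s ij.1) ij.2) =
    (fun ij => b (t ij.1) ij.2) by []; apply/funext => -[[]].
pose J (y : 'I_m -> C) (w : 'I_k * 'I_m -> C) (ij : 'I_k.+1 * 'I_m) : C :=
  if unlift ord0 ij.1 is Some i then w (i, ij.2) else y ij.2.
pose tl (u : 'I_k.+1 -> I) (ij : 'I_k * 'I_m) := b (u (lift ord0 ij.1)) ij.2.
have JE u : (fun ij => b (u ij.1) ij.2) = J (b (u ord0)) (tl u).
  by apply/funext => -[i j]; rewrite /J /tl /=; case: unliftP => [i'|] ->.
have head (u : 'I_k.+1 -> I) : {homo u : i j / (i < j)%N >-> (i < j)%O} ->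
    P (fun ij => b (u ij.1) ij.2) <-> D [set a | P (J (tval a) (tl u))].
  move=> uI; rewrite JE; apply: (@generic_pdef _ _ (fun y =>
    P (J y (tl u))) (gb _)).
  pose f (ij : 'I_k.+1 * 'I_m) : 'I_m + 'I_k * 'I_m :=
    if unlift ord0 ij.1 is Some i then inr (i, ij.2) else inl ij.2.
  have tlB : range (tl u) `<=` A `|` later b (u ord0).
    move=> _ [ij _ <-]; right; exists (u (lift ord0 ij.1)); last by exists ij.2.
    by apply: uI.
  have {}PA := pdef_sub (@subsetUl _ A (later b (u ord0))) PA.
  apply: pdef_ext (pdef_subst f tlB PA) => y.
  suff -> : join_val y (tl u) \o f = J y (tl u) by [].
  by apply/funext => ij; rewrite /J /f /=; case: unlift.
rewrite (head s sI) (head t tI).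
suff -> : [set a : 'I_m -> A | P (J (tval a) (tl s))] =
          [set a | P (J (tval a) (tl t))] by [].
apply: eq_set => a; apply/propext.
apply: (IH (s \o lift ord0) (t \o lift ord0) _ _ (fun w => P (J (tval a) w))).
- by move=> i j ij; apply: sI; rewrite !lift0.
- by move=> i j ij; apply: tI; rewrite !lift0.
pose f (ij : 'I_k.+1 * 'I_m) : 'I_k * 'I_m + 'I_m :=
  if unlift ord0 ij.1 is Some i then inl (i, ij.2) else inr ij.2.
apply: pdef_ext (pdef_subst f (@range_tval _ a) PA) => w.
suff -> : join_val w (tval a) \o f = J (tval a) w by [].
by apply/funext => ij; rewrite /J /f /=; case: unlift.
Qed.

End Fixed.

Section HigherFormulas.
Variables (n : nat) (phi : formula L ('I_n + 'I_m)) (A : set C).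
Hypotheses (satC : saturated K C) (smallK : small K [set: formula L nat]).
Hypotheses (Ainf : infinite_set A) (Asmall : small K A).

(** The sequences of [r] tuples jointly consistent with [l] form a set in the r-fold Fubini power of
    D; the innermost choice heads the list. *)
Fixpoint generically_sat (D : set_system ('I_m -> A)) (r : nat)
    (l : seq ('I_m -> C)) : Prop :=
  if r is r'.+1 then D [set a | generically_sat D r' (tval a :: l)]
  else jointly_sat phi l.

Lemma small_setU (B : set C) : countable B -> small K (A `|` B).
Proof. by move=> cB; apply: small_card_le Asmall;
  exact: card_leU_countable. Qed.

(** Build tuples one after the other, each generic over A and those before it. They are jointly
    consistent, and they are then traded for D-most tuples of A, the last one built first. *)
Lemma higher_formula_generically_sat (D : set_system ('I_m -> A)) (r : nat) :
  higher_formula K (Triple phi D) -> generically_sat D r [::].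
Proof.
move=> [/= DU HD].
pose B (l : seq ('I_m -> C)) := \bigcup_(c in [set c | List.In c l]) range c.
have cB l : countable (B l).
  apply: bigcup_countable => [|c _].
    by apply: finite_set_countable; apply/finite_set_list; exists l.
  apply: finite_set_countable; exact: finite_image.
have /choice[g gP] l : exists b, generic D (A `|` B l) b.
  by apply: generic_exists => //; exact: small_setU.
pose bs k := iter k (fun l => g l :: l) [::].
have bsP k c : List.In c (bs k) <-> exists2 j, (j < k)%N & c = g (bs j).
  elim: k => [|k IH] /=; first by split=> [|[]].
  split=> [[<-|/IH[j jk ->]]|[j]]; [by exists k|by exists j => //;
    exact: ltnW|].
  by rewrite ltnS leq_eqVlt => /orP[/eqP-> ->|jk cj]; [left|right; apply/IH;
    exists j].
(* In the dual order, the tuples later than [k] are those built before it, as [based_on]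
   requires. *)
pose b (k : nat^d) := g (bs k).
have laterE (k : nat^d) : later b k = B (bs k).
  apply/seteqP; split=> x.
    by move=> [j kj xj]; exists (b j) => //; apply/bsP; exists j.
  by move=> [_ /bsP[j jk ->] xj]; exists j.
have gb k : generic D (A `|` later b k) (b k) by rewrite laterE.
have /consistent_range Hb : consistent (range (fun k => PFormula phi (b k))).
  apply: HD.
  - by apply/infiniteP; exact: card_lexx.
  - by apply: small_countable smallK _; exact: (@countableP nat).
  - exact: generic_indiscernible gb.
  - by move=> k; apply: generic_tp (gb k).
(* [l] holds the tuples of A already substituted, which lets the trade proceed by induction. *)
suff H l : (forall c, List.In c l -> range c `<=` A) ->
    generically_sat D r l <-> jointly_sat phi (bs r ++ l).
  apply/H => //; rewrite cats0; have -> // :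
    bs r = [seq b j | j <- rev (iota 0 r)].
  by elim: r {H} => // r IH; rewrite -addn1 iotaD rev_cat map_cat /= add0n -IH
    addn1.
elim: r l => [//|r IH] l lA /=.
have -> : [set a | generically_sat D r (tval a :: l)] =
          [set a : 'I_m -> A | jointly_sat phi (tval a :: bs r ++ l)].
  apply: eq_set => a; apply/propext; rewrite IH; last first.
    by move=> c [<-|/lA//]; exact: range_tval.
  by split; apply: jointly_sat_sub => c; rewrite /= !List.in_app_iff /=; tauto.
rewrite -(@generic_pdef _ _ DU _ _ (fun y =>
  jointly_sat phi (y :: bs r ++ l)) (gP (bs r))) //.
apply: pdef_jointly_sat_cons => c /List.in_app_iff[cr|/lA cA] x cx.
  by right; exists c.
by left; exact: cA.
Qed.

(** Take b1 generic over A and b0 generic over A and b1. This two-term sequence is contradictory;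
    transferring b0 first and b1 second gives the two quantifiers in this order. *)
Lemma one_contradictory_generic (D D' : set_system ('I_m -> A)) :
  UltraFilter D -> UltraFilter D' ->
  one_contradictory K (Triple phi D) (Triple phi D') ->
  D [set a | D' [set a' | ~ jointly_sat phi [:: tval a; tval a']]].
Proof.
move=> DU DU' HD.
have cr (c : 'I_m -> C) : countable (range c).
  by apply: finite_set_countable; exact: finite_image.
have [b1 gb1] := generic_exists DU' satC Asmall.
have [b0 gb0] := generic_exists DU satC (small_setU (cr b1)).
have nb : ~ jointly_sat phi [:: b0; b1].
  (* The index set is [bool] with false < true, each index being its own side. *)
  pose b (s : bool) :
      'I_(t_len (if s then Triple phi D' else Triple phi D)) -> C :=
    match s with true => b1 | false => b0 end.
  rewrite -consistent_pair.
  apply: (HD _ bool id b _ _ false true) => //.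
    by apply: small_countable smallK _; exact: countableP.
  have up (E : set_system ('I_m -> A)) B : Av E B `<=` Av E [set: C].
    by move=> psi [_ ?]; split.
  move=> [] /=; rewrite setUid.
    apply: subset_trans (up _ A); rewrite -(generic_tp DU' gb1).
    move=> psi [psiB ?]; split=> //; apply: subset_trans psiB _ => x [//|].
    by move=> [[] //].
  apply: subset_trans (up _ (A `|` range b1)); rewrite -(generic_tp DU gb0).
  move=> psi [psiB ?]; split=> //; apply: subset_trans psiB _ => x [?|];
    first by left.
  by move=> [[] // _ xb]; right.
have P0 : pdef (A `|` range b1) (fun y => ~ jointly_sat phi [:: y; b1]).
  by apply/pdef_not/pdef_jointly_sat_cons => c [<-|[]]; exact: subsetUr.
apply: filterS (proj1 (generic_pdef DU gb0 P0) nb) => a nab.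
have P1 : pdef A (fun y => ~ jointly_sat phi [:: tval a; y]).
  apply/pdef_not.
  apply: pdef_ext (@pdef_jointly_sat_cons _ _ _ _ phi A [:: tval a] _) =>
    [v|c [<-|[]]].
    by split; exact: jointly_satC.
  exact: range_tval.
exact: (proj1 (generic_pdef DU' gb1 P1) nab).
Qed.

End HigherFormulas.
End Generic.

(** * Finite SOP2 trees *)

Fixpoint in_tree (S : Type) (s : S) (t : tree S) : Prop :=
  if t is Node s' t0 t1 then s = s' \/ in_tree s t0 \/ in_tree s t1 else False.

Fixpoint lookup (S : Type) (s0 : S) (t : tree S) (eta : seq bool) : S :=
  match t with
  | Leaf => s0
  | Node s t0 t1 =>
      if eta is i :: eta' then lookup s0 (if i then t1 else t0) eta' else s
  end.

Lemma filter_in_tree (S T : Type) (D : set_system T) (t : tree S)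
    (P : S -> set T) : Filter D -> (forall s, in_tree s t -> D (P s)) ->
  D [set x | forall s, in_tree s t -> P s x].
Proof.
move=> DF; elim: t => [|s t0 IH0 t1 IH1] /= H.
  by apply: filterS filterT => x _ s [].
have D0 := IH0 (fun u u0 => H u (or_intror (or_introl u0))).
have D1 := IH1 (fun u u1 => H u (or_intror (or_intror u1))).
apply: filterS3 (H s (or_introl erefl)) D0 D1 => x h h0 h1 u.
by case=> [->|[/h0|/h1]].
Qed.

Section Trees.
Variables (L : language) (C : structure L) (n m : nat).
Variables (phi : formula L ('I_n + 'I_m)) (A : set C).

(** [l] collects the labels above the root, so the condition at a leaf is the consistency of its
    whole branch. Incomparable nodes are separated where their paths split. Height [k] means that
    positions of length less than [k] are labelled. *)
Fixpoint SOP2_tree (k : nat) (l : seq ('I_m -> C)) (t : tree ('I_m -> A)) :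
    Prop :=
  match k, t with
  | 0, Leaf => jointly_sat phi l
  | k'.+1, Node a t0 t1 =>
      [/\ SOP2_tree k' (tval a :: l) t0, SOP2_tree k' (tval a :: l) t1 &
          forall a0 a1, in_tree a0 t0 -> in_tree a1 t1 ->
            ~ jointly_sat phi [:: tval a0; tval a1]]
  | _, _ => False
  end.

Lemma in_tree_lookup k l t s0 eta :
  SOP2_tree k l t -> (size eta < k)%N -> in_tree (lookup s0 t eta) t.
Proof.
elim: k l t eta => // k IH l [|a t0 t1] //= [|i eta] [H0 H1 _] /=;
  first by left.
rewrite ltnS => lt_eta; right.
by case: i; [right; apply: IH H1 _|left; apply: IH H0 _].
Qed.

Lemma SOP2_tree_branch k l t s0 eta : SOP2_tree k l t ->
  exists x : 'I_n -> C,
    (forall c, List.In c l -> sat (join_val x c) phi) /\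
    (forall nu, prefix nu eta -> (size nu < k)%N ->
       sat (join_val x (tval (lookup s0 t nu))) phi).
Proof.
elim: k l t eta => [|k IH] l [|a t0 t1] //= eta; first by move=> [x Hx];
  exists x.
move=> [H0 H1 _]; case: eta => [|i eta].
  (* [eta] ends here, so any continuation serves; the left one is taken. *)
  have [x [Hx _]] := IH _ _ [::] H0; exists x; split=> [c cl|[] // _ _].
    by apply: Hx; right.
  by apply: Hx; left.
have Hi : SOP2_tree k (tval a :: l) (if i then t1 else t0) by case: i.
have [x [Hx Hnu]] := IH _ _ eta Hi; exists x; split=> [c cl|[|j nu]].
- by apply: Hx; right.
- by move=> _ _; apply: Hx; left.
- by rewrite /= ltnS => /andP[/eqP ->]; exact: Hnu.
Qed.

Lemma SOP2_tree_incomparable k l t s0 eta nu : SOP2_tree k l t ->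
  (size eta < k)%N -> (size nu < k)%N -> incomparable eta nu ->
  ~ jointly_sat phi [:: tval (lookup s0 t eta); tval (lookup s0 t nu)].
Proof.
elim: k l t eta nu => // k IH l [|a t0 t1] // [|i eta] [|j nu] /= [H0 H1 H];
  rewrite /incomparable ?prefix0s ?andbF //= !ltnS eq_sym.
have [->|] := eqVneq i j => /=.
  by case: j => *; apply: IH; eassumption.
case: i; case: j => //= _ seta snu _.
  by move=> /jointly_satC; apply: H; apply: in_tree_lookup; eassumption.
by apply: H; apply: in_tree_lookup; eassumption.
Qed.

(* The subtree on one side is built against a spare member [D] of the family,
   so that its nodes are inconsistent with [D]-most tuples; by pigeonhole one
   subtree serves more than |A| choices of [D], and these carry the other
   side. *)
Lemma SOP2_tree_exists (F : set (set_system ('I_m -> A))) :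
  embeds nat A -> (forall D, F D -> UltraFilter D) ->
  (forall D D', F D -> F D' -> D <> D' ->
     D [set a | D' [set a' | ~ jointly_sat phi [:: tval a; tval a']]]) ->
  forall (k : nat) (G : set (set_system ('I_m -> A))) (Z : set ('I_m -> A)) l,
  ~ embeds G A -> G `<=` F -> (forall D, G D -> D Z) ->
  (forall D, G D -> generically_sat phi D k l) ->
  exists t, SOP2_tree k l t /\ forall a, in_tree a t -> Z a.
Proof.
move=> Ainf FU Fc.
have AI := embeds_finfun Ainf m.
have ne (G : set (set_system ('I_m -> A))) : ~ embeds G A -> exists D, G D.
  move=> nG; apply: contrapT => nD; apply: nG.
  have nG (x : G) : False by apply: nD; exists (val x); exact: set_valP.
  by exists (fun x => False_rect A (nG x)) => x; case: (nG x).
(* [Z] is the set of labels still allowed; it carries the restrictions imposed by sibling subtrees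
   and must stay large for every member of [G]. *)
elim=> [|k IH] G Z l nG GF GZ Gl.
  by have [D GD] := ne _ nG; exists Leaf; split=> //; exact: (Gl D GD).
have pick D : G D -> exists a, Z a /\ generically_sat phi D k (tval a :: l).
  move=> GD; have DU := FU D (GF D GD).
  exact: (filter_ex (filterI (GZ D GD) (Gl D GD))).
have [D0 GD0] := ne _ nG; have [a0 _] := pick D0 GD0.
have /choice[f fP] D : exists a, G D -> Z a /\ generically_sat phi D k (tval a
  :: l).
  by have [/pick[a ?]|] := pselect (G D); [exists a|exists a0].
(* A single root label [a] works for more than |A| members. *)
have [a nG1] := pigeonhole Ainf f AI nG; set G1 := _ `&` _ in nG1.
have Za : Z a by have [D [GD <-]] := ne _ nG1; case: (fP D GD).
have G1l D : G1 D -> generically_sat phi D k (tval a :: l).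
  by move=> [GD <-]; case: (fP D GD).
have G1F D : G1 D -> F D by move=> [/GF].
have /choice[g gP] D : exists t, G1 D -> SOP2_tree k (tval a :: l) t /\
    forall b, in_tree b t ->
      (Z `&` [set b | D [set a' | ~ jointly_sat phi [:: tval b; tval a']]]) b.
  have [G1D|] := pselect (G1 D); last by exists Leaf.
  have [|||t] := IH (G1 `\ D) (Z `&` [set b | D [set a' | ~ jointly_sat phi [::
    tval b; tval a']]])
    (tval a :: l) (embeds_remove Ainf nG1).
  - by move=> D' [/G1F].
  - move=> D' [G1D' nD'].
    have DU' := FU D' (G1F _ G1D').
    apply: filterI; first by apply: GZ; case: G1D'.
    (* The order matters: [D'] grows the subtree and [D] is the spare, so D'-most b must be
       inconsistent with D-most a'. *)
    exact: (Fc D' D (G1F _ G1D') (G1F _ G1D) nD').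
  - by move=> D' [/G1l].
  - by exists t.
have [t nG2] := pigeonhole Ainf g (embeds_tree Ainf AI) nG1;
  set G2 := _ `&` _ in nG2.
have tP D : G2 D -> SOP2_tree k (tval a :: l) t /\ forall b, in_tree b t ->
    Z b /\ D [set a' | ~ jointly_sat phi [:: tval b; tval a']].
  by move=> [G1D <-]; exact: gP.
have [|||t' [t'P t'Z]] := IH G2
  (Z `&` [set a' | forall b, in_tree b t -> ~ jointly_sat phi [:: tval b;
    tval a']])
  (tval a :: l) nG2.
- by move=> D [/G1F].
- move=> D G2D; have DU := FU D (G1F _ (proj1 G2D)).
  apply: filterI; first by apply: GZ; case: G2D => -[].
  (* The finitely many nodes of [t] impose finitely many D-large conditions. *)
  by apply: filter_in_tree => b bt; exact: (proj2 ((tP D G2D).2 b bt)).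
- by move=> D [/G1l].
have [D2 G2D2] := ne _ nG2; have [tok tZ] := tP _ G2D2.
exists (Node a t t'); split=> [|b [->|[/tZ[]|/t'Z[]]]] //.
by split=> // b b' bt /t'Z[_]; exact.
Qed.

End Trees.

(** * Compactness *)

Section Compactness.
Variables (L : language) (K : Type) (C : structure L) (m : nat).
Hypotheses (satC : saturated K C) (smallK : small K [set: formula L nat]).

Lemma saturated_nonincreasing (B : set C) (P : nat -> ('I_m -> C) -> Prop) :
  small K B -> (forall N, pdef B (P N)) ->
  (forall N a, P N.+1 a -> P N a) -> (forall N, exists a, P N a) ->
  exists a, forall N, P N a.
Proof.
move=> sB PB Pdec Pne.
have /choice[psi psiP] N : exists psi : pformula C m,
    Defs.over B psi /\ forall a, psat a psi <-> P N a.
  by have [psi ? ?] := pdef_pformula (PB N); exists psi.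
have Pmono N M a : (N <= M)%N -> P M a -> P N a.
  by move=> /subnK <-; elim: (M - N)%N => // r IH; rewrite addSn => /Pdec.
have [|q qfin qpsi|a Ha] := satC (p := range psi) sB.
- by move=> _ [N _ <-]; case: (psiP N).
- suff [M HM] : exists M, forall chi, q chi -> exists2 N, (N <= M)%N & chi =
    psi N.
    have [a Pa] := Pne M; exists a => _ /HM[N NM ->].
    by apply/(proj2 (psiP N)); exact: Pmono Pa.
  move/finite_set_list: qfin => [l ql]; rewrite {}ql in qpsi *.
  elim: l qpsi => [|chi l IH] qpsi; first by exists 0.
  have [|M HM] := IH; first by move=> chi' ?; apply: qpsi; right.
  have [N _ NE] := qpsi chi (or_introl erefl).
  exists (maxn M N) => chi' [<-|/HM[N' N'M ->]].
    by exists N => //; exact: leq_maxr.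
  by exists N' => //; exact: leq_trans N'M (leq_maxl _ _).
- exists a => N; apply/(proj2 (psiP N)); apply: Ha; exact: imageT.
Qed.

(** [saturated] realizes types in finitely many variables, so the sequence is built one tuple at a
    time, keeping each initial segment extendable to a solution of every [Q N]. *)
Lemma saturated_sequence (Q : forall N, ('I_N * 'I_m -> C) -> Prop) :
  (forall N, pdef set0 (Q N)) ->
  (forall N (x : nat -> 'I_m -> C),
     Q N.+1 (fun ij => x ij.1 ij.2) -> Q N (fun ij => x ij.1 ij.2)) ->
  (forall N, exists x : nat -> 'I_m -> C, Q N (fun ij => x ij.1 ij.2)) ->
  exists x : nat -> 'I_m -> C, forall N, Q N (fun ij => x ij.1 ij.2).
Proof.
move=> Qdef Qdec Qne.
pose R N (x : nat -> 'I_m -> C) := Q N (fun ij => x ij.1 ij.2).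
pose extends i (x : nat -> 'I_m -> C) :=
  forall N, exists2 y, (forall j, (j < i)%N -> y j = x j) & R N y.
pose upd (x : nat -> 'I_m -> C) i z j := if j == i then z else x j.
have step i x : extends i x -> exists z, extends i.+1 (upd x i z).
  move=> ext; pose P N z := exists2 y,
    (forall j, (j < i)%N -> y j = x j) /\ y i = z & R N y.
  have [||||z Hz] := @saturated_nonincreasing (\bigcup_(j in `I_i) range (x j))
    P.
  - apply: small_countable smallK _; apply: bigcup_countable => // j _.
    by apply: finite_set_countable; exact: finite_image.
  - move=> N.
    pose p (je : 'I_i * 'I_m) := x je.1 je.2.
    (* Indices below [i] become parameters, index [i] is the tuple sought, and the others are
       quantified existentially. *)
    pose f (je : 'I_N * 'I_m) : ('I_m + 'I_N * 'I_m) + 'I_i * 'I_m :=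
      if insub (je.1 : nat) is Some j then inr (j, je.2)
      else if je.1 == i :> nat then inl (inl je.2) else inl (inr je).
    have pB : range p `<=` \bigcup_(j in `I_i) range (x j).
      by move=> _ [[j e] _ <-]; exists j => //=; exists e.
    have QB := pdef_sub (@sub0set _ (\bigcup_(j in `I_i) range (x j))) (Qdef N).
    apply: pdef_ext (pdef_ex_fin (pdef_subst f pB QB)) => z.
    split=> [[w H]|[y [yx <-] H]].
      have [c] := carrier_inhabited C.
      (* The value [c] only fills positions from [N] on, which [Q N] does not read. *)
      exists (fun j => if (j < i)%N then x j else if j == i then z else
        fun e => if insub j is Some j' then w (j', e) else c).
        by split=> [j ->//|]; rewrite ltnn eqxx.
      rewrite /R; move: H; congr (Q N); apply/funext => -[j e]; rewrite /f /=.
      case: insubP => [j' -> jE|/negbTE -> /=]; first by rewrite /p /= jE.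
      by case: eqP => //= _; case: insubP => [j'' _ /val_inj ->|] //;
        rewrite ltn_ord.
    exists (fun je : 'I_N * 'I_m => y je.1 je.2); move: H; rewrite /R;
      congr (Q N).
    apply/funext => -[j e]; rewrite /f /=.
    case: insubP => [j' ji jE|_ /=]; first by rewrite /p /= jE yx.
    by case: eqP => //= ->.
  - by move=> N z [y ? /Qdec ?]; exists y.
  - by move=> N; have [y yx yR] := ext N; exists (y i), y.
  exists z => N; have [y [yx yi] yR] := Hz N; exists y => // j.
  by rewrite ltnS leq_eqVlt /upd => /orP[/eqP->|ji];
    [rewrite eqxx|rewrite (ltn_eqF ji) yx].
have /choice[g gP] (ix : nat * (nat -> 'I_m -> C)) :
    exists z, extends ix.1 ix.2 -> extends ix.1.+1 (upd ix.2 ix.1 z).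
  have [/step[z ?]|] := pselect (extends ix.1 ix.2); first by exists z.
  by have [c] := carrier_inhabited C; exists (fun=> c).
have [x0 _] := Qne 0.
pose X := fix X i := if i is i'.+1 then upd (X i') i' (g (i', X i')) else x0.
have extX i : extends i (X i).
  elim: i => [N|i IH]; first by have [y ?] := Qne N; exists y.
  exact: (gP (i, X i)).
(* Coordinate [j] is set at stage [j.+1] and never changes again, so the limit is read off there. *)
have XE i j : (j < i)%N -> X i j = X j.+1 j.
  elim: i => // i IH; rewrite ltnS leq_eqVlt => /orP[/eqP->//|ji].
  by rewrite -IH //= /upd (ltn_eqF ji).
exists (fun j => X j.+1 j) => N; have [y yX] := extX N N.
rewrite /R; congr (Q N); apply/funext => -[j e] /=.
by rewrite yX ?ltn_ord // XE.
Qed.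

End Compactness.

(* Numbers that do not code a sequence name the root. *)
Definition node (i : nat) : seq bool := odflt [::] (unpickle i).

Lemma pickle_nodeK (eta : seq bool) : node (pickle eta) = eta.
Proof. by rewrite /node pickleK. Qed.

Lemma prefix_mkseq (T : eqType) (f : nat -> T) (j k : nat) :
  (j <= k)%N -> prefix (mkseq f j) (mkseq f k).
Proof.
by move=> jk; rewrite prefixE size_mkseq /mkseq -map_take take_iota (minn_idPl
  jk).
Qed.

Section FiniteToSOP2.
Variables (L : language) (K : Type) (C : structure L) (n m : nat).
Hypotheses (satC : saturated K C) (smallK : small K [set: formula L nat]).
Variables (phi : formula L ('I_n + 'I_m)) (A : set C).

(** Nodes are numbered by their codes, and [Q N] states the SOP2 conditions for the first [N] codes.
    These nodes have bounded length, so a tall enough finite tree satisfies them. *)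
Lemma SOP2_trees_SOP2 (s0 : 'I_m -> A) :
  (forall k, exists t : tree ('I_m -> A), SOP2_tree phi k [::] t) -> SOP2 C.
Proof.
move=> trees.
pose Q N (v : 'I_N * 'I_m -> C) :=
  (forall S : {set 'I_N}, (exists eta, forall i, i \in S -> prefix (node i)
    eta) ->
     jointly_sat phi [seq (fun e => v (i, e)) | i <- enum S]) /\
  (forall i j : 'I_N, incomparable (node i) (node j) ->
     ~ jointly_sat phi [seq (fun e => v (i, e)) | i <- [:: i; j]]).
have [||N|x Hx] := @saturated_sequence L K C m satC smallK Q.
- move=> N.
  have var T (l : seq T) (f : T -> 'I_N) : pdef (C := C) set0
      (fun v : 'I_N * 'I_m -> C => jointly_sat phi [seq (fun e =>
        v (f i, e)) | i <- l]).
    apply: (@pdef_jointly_sat _ _ _ _ _ _ _ _ l (fun i v e =>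
      v (f i, e))) => i _.
    by left; exists (fun e => (f i, e)).
  apply: pdef_and; first by apply: pdef_all_fin => S; apply: pdef_imp;
    [exact: pdef_cst|exact: (var _ _ id)].
  do 2! [apply: pdef_all_fin => ?]; apply: pdef_imp; first exact: pdef_cst.
  by apply: pdef_not; exact: (var _ _ id).
- move=> N x [H1 H2]; split=> [S [eta Seta]|i j].
    have [|y Hy] := H1 (widen_ord (leqnSn N) @: S).
      by exists eta => _ /imsetP[i iS ->]; exact: Seta.
    exists y => c /List.in_map_iff[i [<- /In_mem]]; rewrite mem_enum => iS.
    apply: Hy; apply/List.in_map_iff; exists (widen_ord (leqnSn N) i);
      split=> //.
    by apply/In_mem; rewrite mem_enum imset_f.
  exact: (H2 (widen_ord (leqnSn N) i) (widen_ord (leqnSn N) j)).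
(* The successor is there because a tree of height k labels only lengths below k. *)
- have [t Ht] := trees (\max_(i < N) size (node i)).+1.
  have sz (i : 'I_N) : (size (node i) < (\max_(i < N) size (node i)).+1)%N.
    by rewrite ltnS; exact: (leq_bigmax i).
  exists (fun i => tval (lookup s0 t (node i))); split=> [S [eta Seta]|i j ij].
    have [y [_ Hy]] := SOP2_tree_branch s0 eta Ht.
    exists y => c /List.in_map_iff[i [<- /In_mem]]; rewrite mem_enum => iS.
    exact: (Hy _ (Seta _ iS) (sz i)).
  exact: (SOP2_tree_incomparable Ht (sz i) (sz j) ij).
exists n, m, phi, (fun eta => x (pickle eta)); split=> [eta|eta nu incomp].
  apply/consistent_range => l.
  pose N := (\max_(j <- l) pickle (mkseq eta j)).+1.
  have lN j : j \in l -> (pickle (mkseq eta j) < N)%N.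
    by move=> jl; rewrite ltnS; exact: (leq_bigmax_seq (F := fun j =>
      pickle (mkseq eta j)) j jl isT).
  have [/(_ (finset (fun i : 'I_N => has (fun j =>
    pickle (mkseq eta j) == i) l))) H _] := Hx N.
  apply: jointly_sat_sub (H _) => [c|].
    move=> /List.in_map_iff[j [<- /In_mem jl]].
    apply/List.in_map_iff; exists (Ordinal (lN _ jl)); split=> //.
    by apply/In_mem; rewrite mem_enum inE; apply/hasP; exists j => /=.
  (* The longest initial segment in question extends all the others. *)
  exists (mkseq eta (\max_(j <- l) j)) => i; rewrite inE => /hasP[j jl /eqP <-].
  by rewrite pickle_nodeK; apply: prefix_mkseq;
    exact: (leq_bigmax_seq (F := id) j jl isT).
rewrite consistent_pair.
pose N := (maxn (pickle eta) (pickle nu)).+1.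
have eN : (pickle eta < N)%N by rewrite ltnS leq_maxl.
have nN : (pickle nu < N)%N by rewrite ltnS leq_maxr.
have [_ /(_ (Ordinal eN) (Ordinal nN))] := Hx N.
by rewrite /= !pickle_nodeK => /(_ incomp).
Qed.

End FiniteToSOP2.

(** * The family attached to an SOP2 tree *)

(** [k] is a coordinate where the branches differ; longer initial segments both show the
    disagreement. *)
Lemma mkseq_incomparable (eta nu : nat -> bool) : eta <> nu ->
  exists k, forall j j', (k < j)%N -> (k < j')%N ->
    incomparable (mkseq eta j) (mkseq nu j').
Proof.
move=> neq; have [k nk] : exists k, eta k <> nu k.
  by apply: contrapT => H; apply: neq; apply/funext => k;
    apply: contrapT => nk; apply: H; exists k.
have np (f g : nat -> bool) j j' : f k <> g k -> (k < j)%N -> (k < j')%N ->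
    ~~ prefix (mkseq f j) (mkseq g j').
  move=> fg kj kj'; apply/negP => /prefixP[s E]; apply: fg.
  by rewrite -(nth_mkseq true f kj) -(nth_mkseq true g kj') E nth_cat
    size_mkseq kj.
by exists k => j j' kj kj'; apply/andP; split; apply: np => //; exact/nesym.
Qed.

(** If a formula of the average type failed at [b], its negation would lie in the type of [b] and so
    be D-large too. *)
Lemma generic_of_tp (L : language) (C : structure L) (m : nat) (A : set C)
    (D : set_system ('I_m -> A)) (B : set C) (b : 'I_m -> C) :
  UltraFilter D -> tp b B `<=` Av D [set: C] -> generic D B b.
Proof.
move=> DU H psi [psiB Dpsi]; apply: contrapT => npsi.
have [|_ Dn] := H (PFormula (fNot (pf_formula psi)) (pf_param psi));
  first by split.
have [a [pa npa]] := filter_ex (filterI Dpsi Dn); exact: npa pa.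
Qed.

Section SOP2Family.
Variables (L : language) (C : structure L) (n m : nat).
Variables (phi : formula L ('I_n + 'I_m)) (a : seq bool -> 'I_m -> C).
Hypothesis a_branch : forall (eta : nat -> bool) (l : seq nat),
  jointly_sat phi [seq a (mkseq eta j) | j <- l].
Hypothesis a_incomparable : forall eta nu, incomparable eta nu ->
  ~ jointly_sat phi [:: a eta; a nu].

Definition tree_set : set C := \bigcup_(eta in [set: seq bool]) range (a eta).

Lemma countable_tree_set : countable tree_set.
Proof.
apply: bigcup_countable => // eta _.
by apply: finite_set_countable; exact: finite_image.
Qed.

Lemma tree_set_proof (eta : seq bool) (i : 'I_m) : a eta i \in tree_set.
Proof. by rewrite inE; exists eta => //; exists i. Qed.

Definition tree_tuple (eta : seq bool) (i : 'I_m) : tree_set :=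
  SigSub (tree_set_proof eta i).

Lemma tval_tree_tuple (eta : seq bool) : tval (tree_tuple eta) = a eta.
Proof. by []. Qed.

(** A single instance is consistent, since its node lies on a branch; so equal tuples could not give
    contradictory instances. *)
Lemma tree_tuple_incomparable (eta nu : seq bool) :
  incomparable eta nu -> tree_tuple eta <> tree_tuple nu.
Proof.
move=> en /(congr1 (@tval _ _ _ _)); rewrite !tval_tree_tuple => E.
apply: (a_incomparable en); rewrite -E.
apply: jointly_sat_sub (a_branch (nth true eta) [:: size eta]) => c /=.
by rewrite mkseq_nth; tauto.
Qed.

(** The nodes 1...10 form an infinite antichain, hence carry pairwise distinct tuples, whereas a
    finite set has finitely many m-tuples. *)
Lemma infinite_tree_set : infinite_set tree_set.
Proof.
move=> [r /card_eqPle[/card_le_embeds[e eI] _]].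
(* [inord] lands in a nonempty ordinal, hence [r.+1] instead of [r]. *)
pose f (j : nat) : {ffun 'I_m -> 'I_r.+1} :=
  [ffun i => inord (val (e (tree_tuple (rcons (nseq j true) false) i)))].
have fI : injective f.
  move=> j j' /ffunP E; apply: contrapT => /eqP jj'.
  apply: (@tree_tuple_incomparable (rcons (nseq j true) false) (rcons (nseq j'
    true) false)).
    have np k k' : k != k' ->
        ~~ prefix (rcons (nseq k true) false) (rcons (nseq k' true) false).
      by elim: k k' => [|k IH] [|k'] //= /IH.
    by apply/andP; split; apply: np; rewrite // eq_sym.
  apply/funext => i; apply/eI/val_inj; move/(congr1 val): (E i);
    rewrite !ffunE /=.
  by rewrite !inordK // ltnS ltnW //; exact: (set_valP (e _)).
have : (#|'I_#|{ffun 'I_m -> 'I_r.+1}|.+1| <= #|{ffun 'I_m -> 'I_r.+1}|)%N.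
  by apply: (@leq_card _ _ (f \o val)); exact: inj_comp fI val_inj.
by rewrite card_ord ltnn.
Qed.

Definition on_branch (D : set_system ('I_m -> tree_set)) (eta : nat -> bool) :
    Prop :=
  UltraFilter D /\
  forall k, D [set c | exists2 j, (k < j)%N & c = tree_tuple (mkseq eta j)].

Lemma on_branch_exists (eta : nat -> bool) : exists D, on_branch D eta.
Proof.
pose F : set_system ('I_m -> tree_set) :=
  [set X | exists k, forall j, (k < j)%N -> X (tree_tuple (mkseq eta j))].
have FF : ProperFilter F.
  split; first by move=> [k /(_ k.+1)]; exact.
  split; first by exists 0.
    move=> X Y [k HX] [k' HY]; exists (maxn k k') => j.
    by rewrite gtn_max => /andP[kj k'j]; split; [exact: HX|exact: HY].
  by move=> X Y XY [k HX]; exists k => j /HX/XY.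
have [D [DU FD]] := ultraFilterLemma FF.
by exists D; split=> // k; apply: FD; exists k => j kj; exists j.
Qed.

Lemma on_branch_unique D eta nu : on_branch D eta -> on_branch D nu -> eta = nu.
Proof.
move=> [DU De] [_ Dn]; apply: contrapT => /mkseq_incomparable[k Hk].
have [c [[j kj ->] [j' kj' E]]] := filter_ex (filterI (De k) (Dn k)).
exact: tree_tuple_incomparable (Hk j j' kj kj') E.
Qed.

(** Tuples are traded for nodes of the branch, least index first, until only the consistency of the
    branch is left to use. *)
Lemma on_branch_higher_formula K D eta :
  on_branch D eta -> higher_formula K (Triple phi D).
Proof.
move=> [DU De]; split=> //= d I b _ _ _ based; apply/consistent_range => l.
(* [l0] lists the nodes already traded in; sortedness puts the rest of [l'] among the tuples later
   than its head. *)
suff H (l' : seq I) (l0 : seq nat) : sorted <%O l' ->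
    jointly_sat phi ([seq b s | s <- l'] ++ [seq a (mkseq eta j) | j <- l0]).
  apply: jointly_sat_sub (H (sort <=%O (undup l))%O [::] _).
    move=> c /List.in_map_iff[s [<- /In_mem sl]]; rewrite cats0.
    by apply/List.in_map_iff; exists s; split=> //; apply/In_mem;
      rewrite mem_sort mem_undup.
  by rewrite Order.TotalTheory.sort_lt_sorted undup_uniq.
elim: l' l0 => [|s l' IH] l0 sl'; first exact: a_branch.
have gb : generic D (tree_set `|` later b s) (b s) by rewrite /generic -based
  => psi [].
have P : pdef (tree_set `|` later b s) (fun y => jointly_sat phi
    (y :: [seq b s | s <- l'] ++ [seq a (mkseq eta j) | j <- l0])).
  apply: pdef_jointly_sat_cons => c /List.in_app_iff[|]
    /List.in_map_iff[j [<- jl]] x xj.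
    right; exists j => //=.
    move: sl' => /= /(order_path_min Order.POrderTheory.lt_trans)/allP; apply.
    exact/In_mem.
  by left; exists (mkseq eta j).
apply: (proj2 (generic_pdef DU gb P)); apply: filterS (De 0) => c [j _ ->].
apply: jointly_sat_sub (IH (j :: l0) _); last exact: path_sorted sl'.
by move=> c'; rewrite /= !List.in_app_iff /= tval_tree_tuple; tauto.
Qed.

(** Past the splitting coordinate, b0 is replaced by a node of one tail and then b1 by a node of the
    other; these nodes are incomparable. *)
Lemma on_branch_one_contradictory K D D' eta nu :
  on_branch D eta -> on_branch D' nu -> eta <> nu ->
  one_contradictory K (Triple phi D) (Triple phi D').
Proof.
move=> [DU De] [DU' Dn] /mkseq_incomparable[k Hk]
  h d I side b _ Htp s0 s1 s01 e0 e1.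
have H0 := Htp s0; have H1 := Htp s1.
have b1l : range (b s1) `<=` later b s0 by move=> x ?; exists s1.
(* The lengths of [b s0] and [b s1] depend on [side]; naming the later sets frees both tuples so
   that the sides can be rewritten. *)
set B0 := later b s0 in H0 b1l; set B1 := later b s1 in H1.
move: (b s0) (b s1) H0 H1 b1l; rewrite e0 e1 /= => b0 b1 H0 H1 b1l.
rewrite consistent_pair.
have gb0 := generic_of_tp DU H0; have gb1 := generic_of_tp DU' H1.
have P0 : pdef (tree_set `|` tree_set `|` B0) (fun y =>
  ~ jointly_sat phi [:: y; b1]).
  by apply/pdef_not/pdef_jointly_sat_cons => c [<-|[]//] x /b1l; right.
apply: (proj2 (generic_pdef DU gb0 P0)); apply: filterS (De k) => c [j kj ->].
have P1 : pdef (tree_set `|` tree_set `|` B1)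
    (fun y => ~ jointly_sat phi [:: y; a (mkseq eta j)]).
  apply/pdef_not/pdef_jointly_sat_cons => _ [<-|[]//] x xj.
  by left; left; exists (mkseq eta j).
rewrite /= tval_tree_tuple => /jointly_satC;
  apply: (proj2 (generic_pdef DU' gb1 P1)).
apply: filterS (Dn k) => _ [j' kj' ->] /=;
  rewrite tval_tree_tuple => /jointly_satC.
exact: a_incomparable (Hk _ _ kj kj').
Qed.

(** An ultrafilter determines its branch, so embedding the family in the countable tree set would
    embed [nat -> bool] in [nat]. *)
Lemma large_family (K : Type) :
  exists2 F : set (set_system ('I_m -> tree_set)),
    pairwise_one_contradictory_family K phi F & ~ (F #<= tree_set).
Proof.
have /choice[D DP] := on_branch_exists.
exists (range D).
  split=> [_ [eta _ <-]|_ _ [eta _ <-] [nu _ <-] neq].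
    exact: on_branch_higher_formula (DP eta).
  by apply: on_branch_one_contradictory (DP eta) (DP nu) _ => E; apply: neq;
    rewrite E.
move=> /card_le_trans/(_ countable_tree_set)/countable_injP[f fI].
apply: cantor_bool_seq; exists (f \o D) => eta nu /= E.
apply: (@on_branch_unique (D eta)) (DP eta) _; rewrite (fI _ _ _ _ E) ?inE //.
Qed.

End SOP2Family.

Theorem theorem8p19 (L : language) (T : set (sentence L)) (K : Type)
    (C : structure L) (hT : complete_theory T) (hC : monster K T C) :
  (forall A : set C, infinite_set A -> small K A ->
     forall (n m : nat) (phi : formula L ('I_n + 'I_m))
            (F : set (set_system ('I_m -> A))),
       pairwise_one_contradictory_family K phi F -> F #<= A)
  <-> NSOP2 C.
Proof.
case: hC => _ smallK satC _; split.
  move=> H [n [m [phi [a [branch incomp]]]]].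
  have a_branch eta l : jointly_sat phi [seq a (mkseq eta j) | j <- l].
    exact: (proj1 (consistent_range _ _) (branch eta)).
  have a_incomp eta nu :
      incomparable eta nu -> ~ jointly_sat phi [:: a eta; a nu].
    by rewrite -consistent_pair; exact: incomp.
  have [F famF] := large_family a_branch a_incomp K; apply.
  apply: H famF; first exact: (infinite_tree_set a_branch a_incomp).
  exact: small_countable smallK (countable_tree_set a).
move=> nsop A Ainf Asmall n m phi F [Fh Fc]; apply: contrapT => nF; apply: nsop.
have nA : embeds nat A by apply/cardT_le_embeds/infiniteP.
have FU D : F D -> UltraFilter D by move=> /Fh[].
have [e _] := nA.
(* The constant tuple at [e 0] is the default label for positions off a finite tree. *)
apply: (@SOP2_trees_SOP2 _ _ _ _ _ satC smallK phi A (fun=> e 0)) => k.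
have Fg D D' : F D -> F D' -> D <> D' ->
    D [set a | D' [set a' | ~ jointly_sat phi [:: tval a; tval a']]].
  move=> FD FD' /(Fc _ _ FD FD') DD'.
  exact: (one_contradictory_generic satC smallK Ainf Asmall
            (FU _ FD) (FU _ FD') DD').
(* At the root the whole family is available and no label is excluded. *)
have [||||t [Ht _]] := SOP2_tree_exists nA FU Fg
  (k := k) (G := F) (Z := setT) (l := [::]).
- by move/card_le_embeds: nF.
- by [].
- by move=> D /FU DU; exact: filterT.
- by move=> D /Fh; exact: higher_formula_generically_sat.
- by exists t.
Qed.
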